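(* Let $(X,d)$ be a metric space with $|X|\geqslant 3$ and let $T\colon X\to X$ be a generalized Chatterjea type mapping on $X$. If $x^*\in X$ is a fixed point of $T$, then $T$ is continuous at $x^*$.
   Context: For a metric space $(X,d)$ with $|X|\geqslant 3$, a mapping $T\colon X\to X$ is called a generalized Chatterjea type mapping on $X$ if there exists $\gamma\in[0,\frac13)$ such that $$d(Tx,Ty)+d(Ty,Tz)+d(Tx,Tz)\leqslant \gamma\,(d(x,Ty)+d(x,Tz)+d(y,Tx)+d(y,Tz)+d(z,Tx)+d(z,Ty))$$ holds for all three pairwise distinct points $x,y,z\in X$. *)

(* Defs.v *)
From HB Require Import structures.
From mathcomp Require Import all_boot all_order all_algebra.
From mathcomp Require Import all_classical all_reals all_analysis.
Set Implicit Arguments.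
Unset Strict Implicit.
Unset Printing Implicit Defensive.
Import Order.TTheory GRing.Theory Num.Theory.
Local Open Scope classical_set_scope.
Local Open Scope ring_scope.

Definition generalized_chatterjea (R : realType) (X : metricType R)
    (T : X -> X) : Prop :=
  exists gamma : R, 0 <= gamma < 1 / 3 /\
    forall x y z : X, x != y -> y != z -> x != z ->
      mdist (T x) (T y) + mdist (T y) (T z) + mdist (T x) (T z) <=
        gamma * (mdist x (T y) + mdist x (T z) + mdist y (T x) +
                 mdist y (T z) + mdist z (T x) + mdist z (T y)).

(* Main.v *)
(** Let [p] be the fixed point. Applying the inequality to [p], [x], [y] and
    the triangle inequality through [p], one gets, since [gamma < 1/3],
    [d(p, T x) + d(p, T y) <= 2 (d(p, x) + d(p, y))]. If [p] is not isolated,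
    fix [y <> p] close to [p] and take [x] closer to [p] than [y]. *)
Require Import Defs.
From mathcomp Require Import all_boot all_order all_algebra.
From mathcomp Require Import all_classical all_reals all_analysis.
From mathcomp Require Import lra.
Import Order.TTheory GRing.Theory Num.Theory.
Local Open Scope classical_set_scope.
Local Open Scope card_scope.
Local Open Scope ring_scope.

Lemma generalized_chatterjea_fixed_bound (R : realType) (X : metricType R)
    (T : X -> X) (p x y : X) :
  generalized_chatterjea T -> T p = p -> p != x -> x != y -> p != y ->
  mdist p (T x) + mdist p (T y) <= 2 * (mdist p x + mdist p y).
Proof.
move=> [g [/andP[g0 g3] hT]] Tp px xy py.
have := hT p x y px xy py; rewrite Tp.
have := metric_triangle x p (T y).
have := metric_triangle y p (T x).
rewrite (metric_sym x p) (metric_sym y p).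
have := mdist_ge0 (T x) (T y); have := mdist_ge0 p (T x).
have := mdist_ge0 p (T y); have := mdist_ge0 p x; have := mdist_ge0 p y.
set a := mdist p (T x); set b := mdist p (T y).
set u := mdist p x; set v := mdist p y => v0 u0 b0 a0 c0 hy hx h.
(* Through [p], [mdist x (T y)] is at most [u + b] and [mdist y (T x)] at most [v + a]. *)
have : g * (a + b + u + mdist x (T y) + v + mdist y (T x)) <=
       g * (2 * (a + b + u + v)) by apply: ler_wpM2l => //; lra.
have : g * (2 * (a + b + u + v)) <= 1 / 3 * (2 * (a + b + u + v)).
  by apply: ler_wpM2r; [lra | exact: ltW].
(* Dropping [mdist (T x) (T y)] leaves [a + b <= 2/3 * (a + b + u + v)]; solve for [a + b]. *)
lra.
Qed.

Theorem proposition3p7 (R : realType) (X : metricType R)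
    (cardX : `I_3 #<= [set: X]) (T : X -> X)
    (hT : generalized_chatterjea T) (xstar : X) (fixT : T xstar = xstar) :
  {for xstar, continuous T}.
Proof.
suff small e : 0 < e -> exists2 d : R, 0 < d &
    forall x, mdist xstar x < d -> mdist xstar (T x) < e.
  rewrite /prop_for /continuous_at fixT.
  apply/cvg_ballP => e /small[d d0 hd].
  apply/nbhs_ballP; exists d => //= x.
  by rewrite !ballEmdist; exact: hd.
(* With both points within [e / 4] of [xstar], the bound of the lemma is below
   [2 * (e / 4 + e / 4) = e]. *)
move=> e0; have e40 : 0 < e / 4 by rewrite divr_gt0.
have [[y [yp ye]]|noy] :=
    pselect (exists y, xstar != y /\ mdist xstar y < e / 4).
  (* This radius both keeps [x] within [e / 4] and forces [x != y]. *)
  exists (mdist xstar y); first by rewrite mdist_gt0.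
  move=> x xy; have [<-|px] := eqVneq xstar x; first by rewrite fixT mdistxx.
  have neq_xy : x != y by apply: contraTneq xy => ->; rewrite ltxx.
  have := generalized_chatterjea_fixed_bound _ _ _ _ _ _ hT fixT px neq_xy yp.
  have := mdist_ge0 xstar (T y); lra.
(* Here [xstar] is isolated: its [e / 4]-ball contains no other point. *)
exists (e / 4) => // x xe; have [<-|px] := eqVneq xstar x.
  by rewrite fixT mdistxx.
by case: noy; exists x.
Qed.
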